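(* Let $G$ be a finite graph and for $\rho\in\mathcal O(G)$ let $[\rho]$ be its cut-Eulerian equivalence class. Then $$\kappa_{\mathbb Z}(G;x,y)=\sum_{[\rho]\in[\mathcal O(G)]}\#[\rho]\,\kappa_\rho(G;x,y),\qquad \bar\kappa_{\mathbb Z}(G;x,y)=\sum_{[\rho]\in[\mathcal O(G)]}\#[\rho]\,\bar\kappa_\rho(G;x,y),$$ the sums taken over one representative $\rho$ per class. Furthermore, if $\#[\rho]=c$ for all $\rho\in\mathcal O(G)$, then $\kappa_{\mathbb Z}(G;x,y)=c\,\kappa(G;x,y)$ and $\bar\kappa_{\mathbb Z}(G;x,y)=c\,\bar\kappa(G;x,y)$.
   Context: $G=(V,E)$ is a finite graph, loops and multiple edges allowed. An orientation chooses for each edge one of its two directions (loops also have two); $\mathcal O(G)$ is the set of orientations; $E(\rho\ne\sigma)$ is the set of edges where they differ. For an abelian group $A$, $g:E\to A$ is an $A$-flow of $(G,\varepsilon)$ if at each vertex the sum over incoming edges equals the sum over outgoing edges; $f$ is an $A$-tension if $f(e)=h(u)-h(v)$ for each edge directed from $u$ to $v$, some $h:V\to A$; integer tensions/flows have $A=\mathbb Z$; $\ker f=\{e:f(e)=0\}$, $\operatorname{supp}g=\{e:g(e)\ne0\}$. A bond is a minimal nonempty $[S,V\setminus S]$, directed if all its edges point the same way across; a locally directed cut is an edge set $[S,V\setminus S]$ with an orientation making it a disjoint union of directed bonds; a directed Eulerian subgraph is an edge set with an orientation with equal in- and out-degree at every vertex. $\rho\sim_{ce}\sigma$ if $E(\rho\ne\sigma)$,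 oriented by $\rho$, is a disjoint union of a locally directed cut and a directed Eulerian subgraph (either possibly empty); classes $[\rho]$, set of classes $[\mathcal O(G)]$. For $\rho\in\mathcal O(G)$: $\kappa_\rho(G;p,q)$ is the number of pairs $(f,g)$ (integer tension, integer flow of $(G,\rho)$) with $f(e)g(e)=0$, $f(e)+g(e)>0$, $0\le f(e)<p$, $0\le g(e)<q$ for all $e$; $\bar\kappa_\rho(G;p,q)$ is the number with $0\le f\le p$, $0\le g\le q$ edgewise. For a fixed orientation $\varepsilon$: $\kappa_{\mathbb Z}(G;p,q)$ is the number of pairs $(f,g)$ (integer tension, integer flow of $(G,\varepsilon)$) with $f(e)g(e)=0$, $f(e)+g(e)\ne0$, $|f(e)|<p$, $|g(e)|<q$ for all $e$; $\bar\kappa_{\mathbb Z}=\sum_{\rho\in\mathcal O(G)}\bar\kappa_\rho$; $\kappa(G;p,q)$ is the number of pairs ($A$-tension $f$, $B$-flow $g$ of $(G,\varepsilon)$) with $\ker f=\operatorname{supp}g$, $|A|=p$, $|B|=q$; $\bar\kappa=\sum\bar\kappa_\rho$ over one representative per class. All these agree with polynomials in $(p,q)$, written with variables $x,y$. *)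

(* Defs.v *)
(* The classical files provide the cardinality of sets of integer points.  They
   are imported first, so that unqualified names such as [set0] denote those of
   finset. *)
From HB Require Import structures.
From mathcomp Require Import finmap boolp classical_sets cardinality.
From mathcomp Require Import all_boot all_order all_algebra.
Set Implicit Arguments.
Unset Strict Implicit.
Unset Printing Implicit Defensive.
Import Order.TTheory GRing.Theory Num.Theory.
Local Open Scope ring_scope.

(* Finite multigraph, loops and multiple edges allowed.  The order of the pair
   [ends e] carries no meaning: it only names the two ends of [e], so that a
   direction of [e] can be encoded by a boolean (two directions for a loop as
   well). *)
Record multigraph := Multigraph {
  vertex : finType;
  edge : finType;
  ends : edge -> vertex * vertex }.

Definition orientation (G : multigraph) := {ffun edge G -> bool}.

Section Defs.
Variable G : multigraph.
Implicit Types (rho sigma eps : orientation G) (S : {set vertex G})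
  (B C D : {set edge G}) (p q : nat).

Definition tail rho (e : edge G) := if rho e then (ends e).1 else (ends e).2.
Definition head rho (e : edge G) := if rho e then (ends e).2 else (ends e).1.

(* [S, V \ S] *)
Definition cut S : {set edge G} :=
  [set e | ((ends e).1 \in S) != ((ends e).2 \in S)].

Definition bond B : bool :=
  minset (fun B' : {set edge G} => (B' != set0) && [exists S, B' == cut S]) B.

(* Replacing S by its complement exchanges the two sides, so asking that all
   edges leave S covers both directions across the bond. *)
Definition directed_bond rho B : bool :=
  bond B && [exists S, (B == cut S) && [forall e in B, tail rho e \in S]].

Definition locally_directed_cut rho C : bool :=
  [exists S, C == cut S] &&
  [exists P : {set {set edge G}},
     partition P C && [forall B in P, directed_bond rho B]].

Definition directed_eulerian rho D : bool :=
  [forall v, #|[set e in D | head rho e == v]|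
             == #|[set e in D | tail rho e == v]|].

Definition diff_edges rho sigma : {set edge G} := [set e | rho e != sigma e].

Definition cut_eulerian rho sigma : bool :=
  [exists C : {set edge G}, exists D : {set edge G},
     [&& locally_directed_cut rho C, directed_eulerian rho D,
         [disjoint C & D] & C :|: D == diff_edges rho sigma]].

Definition ce_class rho : {set orientation G} :=
  [set sigma | cut_eulerian rho sigma].

Definition ce_classes : {set {set orientation G}} :=
  [set ce_class rho | rho : orientation G].

Definition is_tension (A : zmodType) eps (f : {ffun edge G -> A}) : Prop :=
  exists h : {ffun vertex G -> A},
    forall e, f e = h (tail eps e) - h (head eps e).

Definition is_flow (B : zmodType) eps (g : {ffun edge G -> B}) : Prop :=
  forall v, \sum_(e | head eps e == v) g e = \sum_(e | tail eps e == v) g e.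

Definition ker_edges (A : zmodType) (f : {ffun edge G -> A}) : {set edge G} :=
  [set e | f e == 0].

Definition supp_edges (A : zmodType) (f : {ffun edge G -> A}) : {set edge G} :=
  [set e | f e != 0].

(* Number of pairs (A-tension, B-flow) of (G, eps) such that [P].  [fset_set]
   sends infinite sets to the empty one; in every use below the set of pairs is
   finite, by bounds on the values or by finiteness of A and B. *)
Definition count_tension_flows (A B : zmodType) eps
    (P : {ffun edge G -> A} -> {ffun edge G -> B} -> Prop) : nat :=
  #|` fset_set [set fg : {ffun edge G -> A} * {ffun edge G -> B} |
        [/\ is_tension eps fg.1, is_flow eps fg.2 & P fg.1 fg.2]]%classic |.

Definition kappa_rho rho p q : nat :=
  @count_tension_flows int int rho (fun f g => forall e,
    [/\ f e * g e = 0, 0 < f e + g e,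
        0 <= f e < p%:Z & 0 <= g e < q%:Z]).

(* The condition f(e) g(e) = 0 would be redundant here: a tension and a flow
   are orthogonal, so nonnegative ones have disjoint supports. *)
Definition kappabar_rho rho p q : nat :=
  @count_tension_flows int int rho (fun f g => forall e,
    0 <= f e <= p%:Z /\ 0 <= g e <= q%:Z).

Definition kappaZ eps p q : nat :=
  @count_tension_flows int int eps (fun f g => forall e,
    [/\ f e * g e = 0, f e + g e != 0,
        `|f e| < p%:Z & `|g e| < q%:Z]).

Definition kappabarZ p q : nat :=
  (\sum_(rho : orientation G) kappabar_rho rho p q)%N.

Definition kappa eps (A B : finZmodType) : nat :=
  @count_tension_flows A B eps (fun f g => ker_edges f = supp_edges g).

Definition ce_representatives
    (rep : {set orientation G} -> orientation G) : Prop :=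
  forall X, X \in ce_classes -> rep X \in X.

Definition kappabar (rep : {set orientation G} -> orientation G) p q : nat :=
  (\sum_(X in ce_classes) kappabar_rho (rep X) p q)%N.

End Defs.

(* [P] is the polynomial, in the variables x = 'X and y = 'Y, that agrees with
   the counting function [F]; it is unique. *)
Definition agrees (P : {poly {poly rat}}) (F : nat -> nat -> nat) : Prop :=
  forall p q : nat, (0 < p)%N -> (0 < q)%N -> P.[p%:R, q%:R] = (F p q)%:R.

(* Same for the modular count, which is indexed by finite abelian groups and
   depends only on their orders. *)
Definition agrees_mod (P : {poly {poly rat}})
    (F : finZmodType -> finZmodType -> nat) : Prop :=
  forall A B : finZmodType, P.[#|A|%:R, #|B|%:R] = (F A B)%:R.

(* Main.v *)
From mathcomp Require Import finmap boolp classical_sets cardinality.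
From mathcomp Require Import all_boot all_order all_algebra.
From mathcomp Require Import zify ring.
Require Import Defs.
Import Order.TTheory GRing.Theory Num.Theory.
Local Open Scope ring_scope.
Set Implicit Arguments.
Unset Strict Implicit.
Unset Printing Implicit Defensive.

(* Two orientations are cut-Eulerian equivalent exactly when the difference of
   their 0/1 vectors is the sum of an integer tension and an integer flow; the
   two summands are orthogonal and integral, hence automatically supported on
   disjoint sets of edges with values in {0, 1, -1}.  In particular the relation
   is an equivalence.

   A pair counted by [kappaZ] has a sign on every edge, which singles out one
   orientation [rho] and turns it into a pair counted by [kappa_rho].  Reversing
   the cut and the Eulerian part of [rho] by the substitutions f -> p - f and
   g -> q - g shows that [kappa_rho] depends only on the class of [rho].

   Reducing such a pair modulo [p] and [q] gives a pair counted by [kappa] for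
   the cyclic groups.  The pairs with a given reduction correspond bijectively to
   the orientations of one class, and every modular pair has a lift: this is
   immediate for tensions and is Tutte's theorem for flows.  Finally [kappa] only
   depends on the orders of the groups. *)

(** * Tensions, flows and cut-Eulerian equivalence *)

Section Incidence.
Variable G : multigraph.
Implicit Types (rho sigma eps : orientation G) (e : edge G) (v : vertex G)
  (C D : {set edge G}) (f g : {ffun edge G -> int}).

(** A loop gets incidence zero at its vertex, so it never affects conservation. *)
Definition inc rho e v : int := (head rho e == v)%:Z - (tail rho e == v)%:Z.

Lemma is_flowE (B : zmodType) rho (g : {ffun edge G -> B}) :
  is_flow rho g <-> forall v, \sum_e g e *~ inc rho e v = 0.
Proof.
have E v : \sum_e g e *~ inc rho e v
    = \sum_(e | head rho e == v) g e - \sum_(e | tail rho e == v) g e.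
  rewrite [X in _ = X - _]big_mkcond [X in _ = _ - X]big_mkcond -sumrB.
  apply: eq_bigr => e _; rewrite /inc mulrzBr.
  by case: (head rho e == v); case: (tail rho e == v).
split=> H v; first by rewrite E H subrr.
by apply/eqP; rewrite -subr_eq0 -E H.
Qed.

Lemma is_flow_intE rho g :
  is_flow rho g <-> forall v, \sum_e g e * inc rho e v = 0.
Proof.
by split=> [/is_flowE H v|H]; [|apply/is_flowE => v]; rewrite -[RHS](H v);
  apply: eq_bigr => e _; rewrite mulrzz.
Qed.

Lemma sum_inc (A : zmodType) rho e (h : vertex G -> A) :
  \sum_v h v *~ inc rho e v = h (head rho e) - h (tail rho e).
Proof.
under eq_bigr => v _ do rewrite mulrzBr.
rewrite sumrB; congr (_ - _).
  rewrite (bigD1 (head rho e)) //= eqxx big1 ?addr0 // => v /negPf.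
  by rewrite eq_sym => ->.
rewrite (bigD1 (tail rho e)) //= eqxx big1 ?addr0 // => v /negPf.
by rewrite eq_sym => ->.
Qed.

(** With [h] a potential of [f], exchanging the sums leaves minus the sum of [h v] times the net
    inflow of [g] at [v]. *)
Lemma orthogonal_tension_flow rho f g :
  is_tension rho f -> is_flow rho g -> \sum_e f e * g e = 0.
Proof.
move=> [h fE] /is_flow_intE gE.
transitivity (- \sum_v h v * \sum_e g e * inc rho e v); last first.
  by rewrite big1 ?oppr0 // => v _; rewrite gE mulr0.
under [in RHS]eq_bigr => v _ do rewrite big_distrr /=.
rewrite exchange_big -sumrN; apply: eq_bigr => e _.
rewrite fE -opprB -(sum_inc rho e h) mulNr big_distrl /=; congr (- _).
by apply: eq_bigr => v _; rewrite mulrzz; ring.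
Qed.

(** Change of reference orientation: reversing an edge negates the value it carries, for tensions
    and flows alike. *)
Definition flip rho sigma f : {ffun edge G -> int} :=
  [ffun e => (-1) ^+ (rho e != sigma e) * f e].

Lemma flipK rho sigma : cancel (flip rho sigma) (flip sigma rho).
Proof.
move=> f; apply/ffunP=> e; rewrite !ffunE eq_sym mulrA -expr2 sqrr_sign.
by rewrite mul1r.
Qed.

Lemma tension_flip rho sigma f :
  is_tension rho f -> is_tension sigma (flip rho sigma f).
Proof.
move=> [h fE]; exists h => e; rewrite ffunE fE /tail /head.
by case: (rho e); case: (sigma e); rewrite /= ?mulN1r ?mul1r ?opprB.
Qed.

Lemma flow_flip rho sigma g :
  is_flow rho g -> is_flow sigma (flip rho sigma g).
Proof.
move=> /is_flow_intE H; apply/is_flow_intE => v; rewrite -[RHS](H v).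
apply: eq_bigr => e _; rewrite ffunE /inc /tail /head.
by case: (rho e); case: (sigma e) => /=; ring.
Qed.

Lemma tension_lin rho (a b : int) f g :
  is_tension rho f -> is_tension rho g ->
  is_tension rho [ffun e => a * f e + b * g e].
Proof.
move=> [h fE] [k gE]; exists [ffun v => a * h v + b * k v] => e.
by rewrite !ffunE fE gE; ring.
Qed.

Lemma flow_lin rho (a b : int) f g :
  is_flow rho f -> is_flow rho g ->
  is_flow rho [ffun e => a * f e + b * g e].
Proof.
move=> /is_flow_intE H /is_flow_intE K; apply/is_flow_intE => v.
transitivity (a * (\sum_e f e * inc rho e v) + b * (\sum_e g e * inc rho e v)).
  rewrite !big_distrr -big_split; apply: eq_bigr => e _ /=.
  by rewrite ffunE; ring.
by rewrite H K !mulr0 addr0.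
Qed.

Definition ind D : {ffun edge G -> int} := [ffun e => (e \in D)%:Z].

Lemma directed_eulerianP rho D :
  reflect (is_flow rho (ind D)) (directed_eulerian rho D).
Proof.
have E (P : pred (edge G)) :
    \sum_(e | P e) ind D e = #|[set e in D | P e]|%:Z.
  rewrite -sum1_card -natz natr_sum big_mkcond [RHS]big_mkcond /=.
  by apply: eq_bigr => e _; rewrite ffunE inE; case: (P e); case: (e \in D).
apply: (iffP forallP) => H v; first by rewrite !E (eqP (H v)).
by have := H v; rewrite !E => -[->].
Qed.

Lemma cutC (S : {set vertex G}) : cut (~: S) = cut S.
Proof. by apply/setP => e; rewrite !inE; do 2!case: (_ \in S). Qed.

Lemma in_cut rho (S : {set vertex G}) e :
  (e \in cut S) = ((tail rho e \in S) != (head rho e \in S)).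
Proof. by rewrite inE /tail /head; case: (rho e); rewrite // eq_sym. Qed.

Definition directed_cut rho B : bool :=
  [exists S, (B == cut S) && [forall e in B, tail rho e \in S]].

Lemma directed_cutP rho B :
  reflect (exists2 S : {set vertex G}, B = cut S &
            forall e, (head rho e \in S) ==> (tail rho e \in S))
          (directed_cut rho B).
Proof.
apply: (iffP existsP) => [[S /andP[/eqP-> /forall_inP H]]|[S -> H]].
  exists S => // e; apply/implyP => he; apply: contraT => te.
  by have := H e; rewrite (in_cut rho) he (negPf te) => /(_ isT).
exists S; rewrite eqxx; apply/forall_inP => e; rewrite (in_cut rho).
by move/implyP: (H e); do 2!case: (_ \in S) => //; move/(_ isT).
Qed.

(* If [cut S'] were a nonempty cut properly inside the minimal directed cut
   [cut S], no edge would join the two parts that [S'] induces in [S] or in its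
   complement, so that one of [S :&: S'], [S :|: S'] would define a smaller
   directed cut. *)
Lemma minimal_directed_cut_bond rho B :
  minset (fun B' => (B' != set0) && directed_cut rho B') B ->
  directed_bond rho B.
Proof.
case/minsetP => /andP[B0 dB] minB; apply/andP; split=> //.
have [S BE dS] := directed_cutP _ _ dB.
apply/minsetP; split.
  by rewrite B0; apply/existsP; exists S; rewrite BE.
move=> B' /andP[B'0 /existsP[S1 /eqP B'E]] sB'B.
have [e' e'B'] := set0Pn _ B'0.
(* Complementing [S1] if necessary makes [e'] leave the chosen side. *)
have {S1 B'E} [S' B'E [te' he']] : exists2 S' : {set vertex G}, B' = cut S' &
    (tail rho e' \in S') /\ (head rho e' \notin S').
  move: (e'B'); rewrite B'E (in_cut rho); have [te|te] := boolP (tail rho e' \in S1).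
    by case he: (_ \in S1) => // _; exists S1; rewrite ?he.
  case he: (_ \in S1) => // _; exists (~: S1); first by rewrite cutC.
  by rewrite !inE te he.
have sub e : (tail rho e \in S') != (head rho e \in S') ->
             (tail rho e \in S) && (head rho e \notin S).
  rewrite -in_cut -B'E => /(subsetP sB'B); rewrite BE (in_cut rho).
  by move/implyP: (dS e); do 2!case: (_ \in S) => //; move/(_ isT).
apply/eqP; rewrite eqEsubset sB'B /=; apply/subsetP => e eB.
apply: contraT; rewrite B'E (in_cut rho) negbK => /eqP eS'.
have /andP[te he] : (tail rho e \in S) && (head rho e \notin S).
  move: eB; rewrite BE (in_cut rho); move/implyP: (dS e).
  by do 2!case: (_ \in S) => //; move/(_ isT).
have /andP[te1 he1] := sub e' ltac:(by rewrite te' (negPf he')).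
have key (T : {set vertex G}) : (forall e, (head rho e \in T) ==> (tail rho e \in T)) ->
    cut T \subset B -> e' \in cut T -> e \in cut T.
  move=> dT sT e'T; rewrite (minB (cut T)) // ; apply/andP; split.
    by apply/set0Pn; exists e'.
  by apply/directed_cutP; exists T.
case teS': (tail rho e \in S').
  have := key (S :|: S'); rewrite !(in_cut rho) !inE te te' (negPf he1) (negPf he').
  rewrite -eS' teS' !orbT /=; apply => //.
    move=> e1; rewrite !inE; have := sub e1; have := dS e1.
    by do 4!case: (_ \in _) => //=; move=> _; apply.
  apply/subsetP => e1; rewrite BE !(in_cut rho) !inE; have := sub e1; have := dS e1.
  by do 4!case: (_ \in _) => //=; move=> _; apply.
have := key (S :&: S'); rewrite !(in_cut rho) !inE te1 te' (negPf he1) (negPf he').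
rewrite -eS' teS' !andbF /=; apply => //.
  move=> e1; rewrite !inE; have := sub e1; have := dS e1.
  by do 4!case: (_ \in _) => //=; move=> _; apply.
apply/subsetP => e1; rewrite BE !(in_cut rho) !inE; have := sub e1; have := dS e1.
by do 4!case: (_ \in _) => //=; move=> _; apply.
Qed.

Lemma directed_cut_tension rho B :
  directed_cut rho B -> is_tension rho (ind B).
Proof.
case/directed_cutP => S -> dS; exists [ffun v => (v \in S)%:Z] => e.
rewrite !ffunE (in_cut rho); have := dS e.
by do 2!case: (_ \in S).
Qed.

(** Induction on the size of [C]: a nonempty [C] contains a nonempty directed cut, a minimal one is
    a directed bond, and removing it from [C] leaves the indicator of a tension. *)
Lemma tension_bond_partition rho C :
  is_tension rho (ind C) ->
  exists P : {set {set edge G}},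
    partition P C && [forall B in P, directed_bond rho B].
Proof.
elim: {C}_.+1 {-2}C (ltnSn #|C|) => // n IH C; rewrite ltnS => Cn tC.
have [->|/set0Pn[e0 e0C]] := eqVneq C set0.
  exists set0; rewrite partition_set0 eqxx /=.
  by apply/forall_inP => B; rewrite inE.
have [h hE] := tC.
(* Potentials never increase from tail to head, so no edge enters this superlevel set; an edge
   leaving it has a drop in potential, hence lies in [C]. *)
pose S := [set v | h (tail rho e0) <= h v].
have dirS : (cut S != set0) && directed_cut rho (cut S).
  apply/andP; split.
    apply/set0Pn; exists e0; rewrite (in_cut rho) !inE lexx.
    by have := hE e0; rewrite ffunE e0C; lia.
  apply/directed_cutP; exists S => // e; rewrite !inE; apply/implyP.
  by have := hE e; rewrite ffunE; lia.
have [B minB sBS]  :=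
  @minset_exists _ (fun B' => (B' != set0) && directed_cut rho B') _ dirS.
have bB := minimal_directed_cut_bond minB.
have /andP[B0 dB] := minsetp minB.
have sBC : B \subset C.
  apply: subset_trans sBS _; apply/subsetP => e; rewrite (in_cut rho) !inE.
  by have := hE e; rewrite ffunE; case: (e \in C) => //; lia.
have tCB : is_tension rho (ind (C :\: B)).
  have -> : ind (C :\: B) = [ffun e => 1 * ind C e + (-1) * ind B e].
    apply/ffunP => e; rewrite !ffunE inE; have := subsetP sBC e.
    by case: (e \in B) => [->|_] //; case: (e \in C).
  exact: tension_lin tC (directed_cut_tension dB).
have [|P /andP[partP /forall_inP bP]] := IH (C :\: B) _ tCB.
  apply: leq_trans Cn; apply: proper_card; rewrite properEneq subsetDl andbT.
  have [e eB] := set0Pn _ B0; apply/eqP => /setP/(_ e).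
  by rewrite inE eB (subsetP sBC).
exists (B |: P); apply/andP; split; last first.
  by apply/forall_inP => B'; rewrite !inE => /orP[/eqP->|/bP].
rewrite -(setID C B) (setIidPr sBC); apply: partitionU1 => //.
by rewrite disjoints_subset; apply/subsetP => e; rewrite !inE => ->.
Qed.

(** A disjoint union of directed bonds is a tension because the potentials of the bonds add up; the
    converse is the bond partition above. *)
Lemma locally_directed_cutP rho C :
  reflect (is_tension rho (ind C)) (locally_directed_cut rho C).
Proof.
apply: (iffP andP) => [[_ /existsP[P /andP[partP /forall_inP bP]]]|tC].
  have tP B : B \in P -> is_tension rho (ind B).
    by move=> /bP /andP[_] ?; apply: directed_cut_tension.
  elim: {P}#|P| {-2}P (erefl #|P|) C partP tP {bP} => [|n IH] P Pn C partP tP.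
    move/eqP: Pn; rewrite cards_eq0 => /eqP P0.
    exists [ffun=> 0] => e; rewrite !ffunE subr0.
    by rewrite -(cover_partition partP) P0 /cover big_set0 inE.
  have [|B BP] := set0Pn P _; first by rewrite -cards_eq0 Pn.
  have := IH (P :\ B) _ _ (partitionD1 partP BP).
  case=> [||h hE]; first by move: Pn; rewrite (cardsD1 B) BP => -[].
    by move=> B'; rewrite inE => /andP[_] /tP.
  have [k kE] := tP _ BP; exists [ffun v => h v + k v] => e.
  have sBC := partitionS partP BP.
  rewrite !ffunE opprD addrACA -hE -kE !ffunE inE.
  by have := subsetP sBC e; case: (e \in B) => [->|] //; case: (e \in C).
split; last by apply/existsP; apply: tension_bond_partition.
have [h hE] := tC.
(* The potential drops by one on [C] and by zero elsewhere, so its parity changes exactly on [C]. *)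
apply/existsP; exists [set v | odd `|h v|]; apply/eqP/setP => e.
rewrite (in_cut rho) !inE; have := hE e; rewrite ffunE.
by case: (e \in C); lia.
Qed.

(* If [t + u = d] with [t], [u] orthogonal and [d] valued in [0, 1], then
   [t * (d - t)], which is pointwise nonpositive, sums to zero; hence [t] and
   [u] are the restrictions of [d] to disjoint sets of edges. *)
Lemma cut_eulerianP rho sigma :
  reflect (exists t u : {ffun edge G -> int}, [/\ is_tension rho t, is_flow rho u &
             forall e, t e + u e = (rho e != sigma e)%:Z])
          (cut_eulerian rho sigma).
Proof.
apply: (iffP existsP) => [[C /existsP[D /and4P[tC uD dCD /eqP CDE]]]|].
  exists (ind C), (ind D); split; first exact/locally_directed_cutP.
    exact/directed_eulerianP.
  move=> e; have /setP/(_ e) := CDE; rewrite !ffunE !inE => <-.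
  by have := disjointFr dCD (x := e); case: (e \in C) => [->|] //; case: (e \in D).
case=> t [u [tt uu tuE]].
have t01 e : t e = 0 \/ u e = 0.
  have le0 e1 : 0 <= - (t e1 * u e1).
    by have := tuE e1; case: (rho e1 != _) => tu1; nia.
  have /eqP : \sum_e - (t e * u e) = 0.
    by rewrite sumrN (orthogonal_tension_flow tt uu) oppr0.
  rewrite psumr_eq0 // => /allP/(_ e (mem_index_enum e)) /=.
  by rewrite oppr_eq0 mulf_eq0 => /orP[]/eqP; [left|right].
exists [set e | t e == 1]; apply/existsP; exists [set e | u e == 1].
apply/and4P; split.
- apply/locally_directed_cutP; suff -> : ind [set e | t e == 1] = t by [].
  apply/ffunP=> e; rewrite ffunE inE; have := t01 e; have := tuE e.
 by case: (rho e != _); case: eqP; lia.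
- apply/directed_eulerianP; suff -> : ind [set e | u e == 1] = u by [].
  apply/ffunP=> e; rewrite ffunE inE; have := t01 e; have := tuE e.
  by case: (rho e != _); lia.
- rewrite disjoints_subset; apply/subsetP => e; rewrite !inE => /eqP te.
  by have := t01 e; rewrite te => -[|->].
- apply/eqP/setP => e; rewrite !inE.
  by have := t01 e; have := tuE e; case: (rho e != _); lia.
Qed.

Lemma cut_eulerian_ind rho sigma :
  cut_eulerian rho sigma ->
  exists C D, [/\ is_tension rho (ind C), is_flow rho (ind D) &
    forall e, (e \in C)%:Z + (e \in D)%:Z = (rho e != sigma e)%:Z].
Proof.
case/existsP => C /existsP[D /and4P[tC uD dCD /eqP CDE]]; exists C, D.
split; [exact/locally_directed_cutP|exact/directed_eulerianP|move=> e].
have /setP/(_ e) := CDE; rewrite !inE => <-.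
by have := disjointFr dCD (x := e); case: (e \in C) => [->|] //; case: (e \in D).
Qed.

Let base : orientation G := [ffun=> true].

(** With one reference orientation for all pairs, the relation becomes membership of a difference in
    a fixed subgroup, so that it is visibly an equivalence. *)
Lemma cut_eulerian_signed rho sigma :
  cut_eulerian rho sigma <->
  exists t u : {ffun edge G -> int}, [/\ is_tension base t, is_flow base u &
             forall e, t e + u e = (rho e)%:Z - (sigma e)%:Z].
Proof.
split=> [/cut_eulerianP|] [t [u [tt uu tuE]]].
  exists (flip rho base t), (flip rho base u).
  split; [exact: tension_flip|exact: flow_flip|move=> e].
  rewrite !ffunE -mulrDr tuE.
  by case: (rho e); case: (sigma e).
apply/cut_eulerianP; exists (flip base rho t), (flip base rho u).
split; [exact: tension_flip|exact: flow_flip|move=> e].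
rewrite !ffunE -mulrDr tuE.
by case: (rho e); case: (sigma e).
Qed.

Lemma cut_eulerian_refl : reflexive (@cut_eulerian G).
Proof.
move=> rho; pose z : {ffun edge G -> int} := [ffun=> 0].
apply/cut_eulerian_signed; exists z, z.
split=> [||e]; first by exists [ffun=> 0] => e; rewrite !ffunE subrr.
  by apply/is_flow_intE => v; rewrite big1 // => e _; rewrite ffunE mul0r.
by rewrite !ffunE; lia.
Qed.

Lemma cut_eulerian_sym_imp rho sigma :
  cut_eulerian rho sigma -> cut_eulerian sigma rho.
Proof.
move=> /cut_eulerian_signed[t [u [tt uu tuE]]]; apply/cut_eulerian_signed.
exists [ffun e => (-1) * t e + 0 * t e], [ffun e => (-1) * u e + 0 * u e].
split; [exact: tension_lin|exact: flow_lin|move=> e].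
by rewrite !ffunE; have := tuE e; lia.
Qed.

Lemma cut_eulerian_sym : symmetric (@cut_eulerian G).
Proof. by move=> rho sigma; apply/idP/idP => /cut_eulerian_sym_imp. Qed.

Lemma cut_eulerian_trans : transitive (@cut_eulerian G).
Proof.
move=> sigma rho tau /cut_eulerian_signed[t [u [tt uu tuE]]].
move=> /cut_eulerian_signed[t' [u' [tt' uu' tuE']]].
apply/cut_eulerian_signed.
exists [ffun e => 1 * t e + 1 * t' e], [ffun e => 1 * u e + 1 * u' e].
split; [exact: tension_lin|exact: flow_lin|move=> e].
by rewrite !ffunE; have := tuE e; have := tuE' e; lia.
Qed.

Lemma ce_class_eq rho sigma : (ce_class rho == ce_class sigma) = cut_eulerian rho sigma.
Proof.
apply/eqP/idP => [/setP/(_ sigma)|rs].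
  by rewrite !inE cut_eulerian_refl.
apply/setP => tau; rewrite !inE; apply/idP/idP.
  by apply: cut_eulerian_trans; rewrite cut_eulerian_sym.
exact: cut_eulerian_trans rs.
Qed.

Lemma sum_ce_classes (rep : {set orientation G} -> orientation G)
    (F : orientation G -> nat) :
  ce_representatives rep ->
  (forall rho sigma, cut_eulerian rho sigma -> F rho = F sigma) ->
  (\sum_rho F rho = \sum_(X in ce_classes G) #|X| * F (rep X))%N.
Proof.
move=> repP Finv.
rewrite (partition_big (@ce_class G) (mem (ce_classes G))); last first.
  by move=> rho _; apply: imset_f.
apply: eq_bigr => X XC; have repX := repP _ XC.
have /imsetP[rho _ XE] := XC.
rewrite (eq_bigr (fun=> F (rep X))) => [|sigma /eqP sX]; last first.
  by apply: Finv; move: repX; rewrite -sX inE.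
rewrite sum_nat_const; congr (_ * _)%N; apply: eq_card => sigma.
by rewrite [LHS](_ : _ = (ce_class sigma == X)) // XE inE ce_class_eq cut_eulerian_sym.
Qed.

End Incidence.

(** * Counting integer pairs *)

Section FiniteSetCard.
Local Open Scope nat_scope.

Lemma in_fset_setP (T : choiceType) (A : T -> Prop) x :
  finite_set A -> reflect (A x) (x \in fset_set A).
Proof.
by move=> finA; rewrite in_fset_set //; apply: (iffP idP) => [/set_mem|/mem_set].
Qed.

Lemma card_fset_set_bij (T U : choiceType) (A : T -> Prop) (B : U -> Prop)
    (phi : T -> U) (psi : U -> T) :
  (forall x, A x -> B (phi x)) -> (forall y, B y -> A (psi y)) ->
  (forall x, A x -> psi (phi x) = x) -> (forall y, B y -> phi (psi y) = y) ->
  #|` fset_set A| = #|` fset_set B|.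
Proof.
move=> AB BA phiK psiK.
have BE : B = (phi @` A)%classic.
  apply/seteqP; split=> [y By|_ [x Ax <-]]; last exact: AB.
  by exists (psi y); [exact: BA|exact: psiK].
have AE : A = (psi @` B)%classic.
  apply/seteqP; split=> [x Ax|_ [y By <-]]; last exact: BA.
  by exists (phi x); [exact: AB|exact: phiK].
(* The two sets are infinite together, and then [fset_set] sends both to the empty set. *)
have [finA|infA] := pselect (finite_set A); last first.
  have infB : ~ finite_set B by rewrite AE in infA => /(@finite_image _ _ _ psi).
  by rewrite /fset_set; case: pselect => // ?; case: pselect.
rewrite BE fset_set_image // card_in_imfset // => x y xA yA /(congr1 psi).
by rewrite !phiK //; apply/in_fset_setP.
Qed.

Lemma card_fset_set_fibers (T : choiceType) (F : finType) (A : T -> Prop)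
    (pi : T -> F) : finite_set A ->
  #|` fset_set A| = \sum_(y : F) #|` fset_set (fun x => A x /\ pi x = y)|.
Proof.
move=> finA; rewrite card_fset_sum1 (partition_big pi xpredT) //=.
apply: eq_bigr => y _; have finAy : finite_set (fun x => A x /\ pi x = y).
  by apply: sub_finite_set finA => x [].
have -> : fset_set (fun x => A x /\ pi x = y) =
          [fset x in fset_set A | pi x == y]%fset.
  apply/fsetP => x; rewrite !finmap.inE /=; apply/in_fset_setP/andP => //.
    by move=> [Ax <-]; split=> //; apply/in_fset_setP.
  by move=> [/in_fset_setP-/(_ finA) Ax /eqP].
by rewrite card_fset_sum1 big_fset.
Qed.

Lemma card_fset_set_finType (T : finType) (A : T -> Prop) :
  #|` fset_set A| = #|[set x | `[< A x >]]|.
Proof.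
rewrite -(card_fset_set_bij (A := fun x => x \in [set x | `[< A x >]])
  (phi := id) (psi := id)) //.
- have -> : fset_set (fun x => x \in [set x | `[< A x >]]) =
            [fset x in [set x | `[< A x >]]]%fset.
    apply/fsetP => x; rewrite !finmap.inE /=.
    apply/in_fset_setP/asboolP; first exact: finite_finset.
      by rewrite inE => /asboolP.
    by rewrite inE => ?; apply/asboolP.
  by rewrite card_imfset //= -cardE.
- by move=> x; rewrite inE => /asboolP.
- by move=> x Ax; rewrite inE; apply/asboolP.
Qed.

End FiniteSetCard.

(** * Signs of integer pairs and invariance under cut-Eulerian equivalence *)

Section IntegerCounts.
Variable G : multigraph.
Implicit Types (rho sigma eps : orientation G) (e : edge G).
Local Notation efun := {ffun edge G -> int}.

Lemma finite_bounded_pairs (N : nat) (A : efun * efun -> Prop) :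
  (forall fg, A fg -> forall e, `|fg.1 e| <= N%:Z /\ `|fg.2 e| <= N%:Z) ->
  finite_set A.
Proof.
move=> AN; pose F := {ffun edge G -> 'I_(N.*2.+1)}.
(* Values in [-N, N] are encoded by adding [N], so the set lies in the image of a finite type. *)
pose dec (u : F) : efun := [ffun e => (u e : nat)%:Z - N%:Z].
apply: (@sub_finite_set _ _
  ((fun u : F * F => (dec u.1, dec u.2)) @` [set: F * F])%classic); last first.
  by apply: finite_image; exact: finite_finset.
move=> [f g] /AN /= bnd.
exists ([ffun e => inord `|f e + N%:Z|], [ffun e => inord `|g e + N%:Z|]) => //=.
by congr (_, _); apply/ffunP => e; rewrite !ffunE inordK; have [] := bnd e; lia.
Qed.

Lemma mulz_eq0 (x y : int) : x * y = 0 <-> x = 0 \/ y = 0.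
Proof.
split=> [/eqP|[]->]; rewrite ?mul0r ?mulr0 //.
by rewrite mulf_eq0 => /orP[]/eqP; [left|right].
Qed.

Lemma signzE (b : bool) (x : int) : (-1) ^+ b * x = if b then - x else x.
Proof. by case: b; rewrite ?mulN1r ?mul1r. Qed.

Definition pos_pair (p q x y : int) :=
  [/\ x * y = 0, 0 < x + y, 0 <= x < p & 0 <= y < q].

Definition nz_pair (p q x y : int) :=
  [/\ x * y = 0, x + y != 0, `|x| < p & `|y| < q].

(* Restates the count with the canonical instances of [int]: those elaborated in
   [kappa_rho] and [kappaZ] are only convertible to them, which [lia] does not
   see. *)
Lemma kappa_rhoE rho p q : kappa_rho rho p q =
  count_tension_flows rho (fun f g => forall e, pos_pair p q (f e) (g e)).
Proof. by []. Qed.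

Lemma kappaZE eps p q : kappaZ eps p q =
  count_tension_flows eps (fun f g => forall e, nz_pair p q (f e) (g e)).
Proof. by []. Qed.

Lemma nz_pair_sign p q x y (b : bool) :
  nz_pair p q x y -> b = (x + y <= 0) ->
  pos_pair p q ((-1) ^+ b * x) ((-1) ^+ b * y).
Proof.
rewrite !signzE => -[/mulz_eq0 xy0 xyN0 xp yq] ->.
by split; [apply/mulz_eq0|..]; case: (leP (x + y) 0); lia.
Qed.

Lemma pos_pair_sign p q x y (b : bool) : pos_pair p q x y ->
  nz_pair p q ((-1) ^+ b * x) ((-1) ^+ b * y) /\
  (0 < (-1) ^+ b * x + (-1) ^+ b * y) = ~~ b.
Proof.
rewrite !signzE => -[/mulz_eq0 xy0 xyN0 xp yq].
by split; [split; [apply/mulz_eq0|..]|]; case: b; lia.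
Qed.

(** Reverses the edges carrying a negative value, so that the pair becomes positive. *)
Definition sign_orientation eps (fg : efun * efun) : orientation G :=
  [ffun e => eps e == (0 < fg.1 e + fg.2 e)].

Definition nz_pairs eps (p q : nat) (fg : efun * efun) :=
  [/\ is_tension eps fg.1, is_flow eps fg.2 &
      forall e, nz_pair p q (fg.1 e) (fg.2 e)].

Lemma nz_pairs_finite eps p q : finite_set (nz_pairs eps p q).
Proof.
apply: (@finite_bounded_pairs (p + q)) => fg [_ _ H] e.
by have [_ _] := H e; lia.
Qed.

(** Sort the pairs by their sign orientation; [flip] identifies the fibre over [rho] with the pairs
    counted by [kappa_rho]. *)
Lemma kappaZ_sum eps p q :
  kappaZ eps p q = (\sum_(rho : orientation G) kappa_rho rho p q)%N.
Proof.
rewrite kappaZE /count_tension_flows.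
rewrite (card_fset_set_fibers (sign_orientation eps)); last exact: nz_pairs_finite.
apply: eq_bigr => rho _; rewrite kappa_rhoE.
apply: (@card_fset_set_bij _ _ _ _
  (fun fg => (flip eps rho fg.1, flip eps rho fg.2))
  (fun fg => (flip rho eps fg.1, flip rho eps fg.2))).
- move=> [f g] /= [[tf gg H] rhoE]; split=> /=.
  + exact: tension_flip.
  + exact: flow_flip.
  + move=> e; rewrite !ffunE; apply: nz_pair_sign => //.
    by rewrite -rhoE ffunE /= leNgt; case: (eps e); case: (0 < _).
- move=> [f g] /= [tf gg H]; split; first split=> /=.
  + exact: tension_flip.
  + exact: flow_flip.
  + by move=> e; rewrite !ffunE; have [] := pos_pair_sign (rho e != eps e) (H e).
  + apply/ffunP => e; rewrite !ffunE /=.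
    have [_ ->] := pos_pair_sign (rho e != eps e) (H e).
    by case: (rho e); case: (eps e).
- by move=> [f g] _ /=; rewrite !flipK.
- by move=> [f g] _ /=; rewrite !flipK.
Qed.

(** The products sum to zero by orthogonality and are nonnegative, so each of them vanishes. *)
Lemma nonneg_disjoint_support rho (f g : efun) :
  is_tension rho f -> is_flow rho g ->
  (forall e, 0 <= f e) -> (forall e, 0 <= g e) ->
  forall e, f e = 0 \/ g e = 0.
Proof.
move=> tf gg f0 g0 e; apply/mulz_eq0; apply/eqP.
have /eqP := orthogonal_tension_flow tf gg.
rewrite psumr_eq0 => [/allP/(_ e (mem_index_enum e)) //|e' _].
by rewrite mulr_ge0.
Qed.

(** When all edges of [C] are reversed, minus the indicator is carried to the indicator; hence a cut
    or Eulerian part of [rho] is again one for [sigma]. *)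
Lemma flip_ind rho sigma (C : {set edge G}) :
  {subset C <= diff_edges rho sigma} ->
  flip rho sigma [ffun e => 0 * ind C e + (-1) * ind C e] = ind C.
Proof.
move=> sC; apply/ffunP => e; rewrite !ffunE signzE; have := sC e; rewrite inE.
by case: (e \in C) => [->|_] //; case: ifP.
Qed.

(* Reversing the cut [C] and the Eulerian part [D] turns the pair [f, g] into
   [p - f] on [C] and [q - g] on [D]: by orthogonality [g] vanishes on [C] and
   [f] vanishes on [D]. *)
Lemma count_cut_eulerian_eq rho sigma (Q : int -> int -> Prop) (p q : int) :
  (forall x y, Q x y -> 0 <= x /\ 0 <= y) ->
  (forall x, Q x 0 -> Q (p - x) 0) -> (forall y, Q 0 y -> Q 0 (q - y)) ->
  cut_eulerian rho sigma ->
  @count_tension_flows G int int rho (fun f g => forall e, Q (f e) (g e)) =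
  @count_tension_flows G int int sigma (fun f g => forall e, Q (f e) (g e)).
Proof.
move=> Q0 QC QD /cut_eulerian_ind[C [D [tC uD CDE]]].
have sC : {subset C <= diff_edges rho sigma}.
  by move=> e eC; rewrite inE; have := CDE e; rewrite eC; case: (rho e != _); lia.
have sD : {subset D <= diff_edges rho sigma}.
  by move=> e eD; rewrite inE; have := CDE e; rewrite eD; case: (rho e != _); lia.
have tC' : is_tension sigma (ind C).
  by rewrite -(flip_ind sC); apply/tension_flip/tension_lin.
have uD' : is_flow sigma (ind D).
  by rewrite -(flip_ind sD); apply/flow_flip/flow_lin.
(* Subtracting [p] on [C] before the sign change yields [p - f] there, while on [D] only zeros of
   [f] are negated; likewise for [g], with [q] and [D]. *)
pose mv (tau tau' : orientation G) (fg : efun * efun) : efun * efun :=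
  (flip tau tau' [ffun e => 1 * fg.1 e + (- p) * ind C e],
   flip tau tau' [ffun e => 1 * fg.2 e + (- q) * ind D e]).
have mvP tau tau' (fg : efun * efun) : diff_edges tau tau' = diff_edges rho sigma ->
    is_tension tau (ind C) -> is_flow tau (ind D) ->
    [/\ is_tension tau fg.1, is_flow tau fg.2 & forall e, Q (fg.1 e) (fg.2 e)] ->
    [/\ is_tension tau' (mv tau tau' fg).1, is_flow tau' (mv tau tau' fg).2 &
        forall e, Q ((mv tau tau' fg).1 e) ((mv tau tau' fg).2 e)].
  move=> dE tCt uDt [tf ug H]; split.
  - by apply/tension_flip/tension_lin.
  - by apply/flow_flip/flow_lin.
  - move=> e.
    have f0 e' : 0 <= fg.1 e' by have [] := Q0 _ _ (H e').
    have g0 e' : 0 <= fg.2 e' by have [] := Q0 _ _ (H e').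
    have i0 (X : {set edge G}) e' : 0 <= ind X e' by rewrite ffunE.
    have := nonneg_disjoint_support tf uDt f0 (i0 D) e.
    have := nonneg_disjoint_support tCt ug (i0 C) g0 e.
    have := H e; have := CDE e; have /setP/(_ e) := dE.
    rewrite !inE !ffunE !signzE => ->; move: (fg.1 e) (fg.2 e) => x y.
    case: (e \in C); case: (e \in D); case: (rho e != sigma e) => //= _.
    + by move=> Qxy [//|y0] _; move: Qxy; rewrite y0 => /QC; congr Q; lia.
    + by move=> Qxy _ [x0|//]; move: Qxy; rewrite x0 => /QD; congr Q; lia.
    + by move=> Qxy _ _; move: Qxy; congr Q; lia.
have mvK tau tau' : diff_edges tau tau' = diff_edges rho sigma ->
    cancel (mv tau tau') (mv tau' tau).
  move=> dE [f g]; rewrite /mv /=; congr (_, _); apply/ffunP => e;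
    have := CDE e; have /setP/(_ e) := dE;
    rewrite !inE !ffunE !signzE [tau' e == _]eq_sym => ->;
    by case: (e \in C); case: (e \in D); case: (rho e != sigma e) => //= _; lia.
have dE : diff_edges sigma rho = diff_edges rho sigma.
  by apply/setP => e; rewrite !inE eq_sym.
apply: (@card_fset_set_bij _ _ _ _ (mv rho sigma) (mv sigma rho)) => fg.
- exact: mvP.
- exact: mvP.
- by rewrite mvK.
- by rewrite mvK.
Qed.

Lemma kappa_rho_ce rho sigma p q :
  cut_eulerian rho sigma -> kappa_rho rho p q = kappa_rho sigma p q.
Proof.
rewrite !kappa_rhoE; apply: (@count_cut_eulerian_eq _ _ _ p%:Z q%:Z).
- by move=> x y [_ _ /andP[-> _] /andP[-> _]].
- by move=> x []; rewrite /pos_pair mulr0; split=> //; lia.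
- by move=> x []; rewrite /pos_pair mul0r; split=> //; lia.
Qed.

Lemma kappabar_rho_ce rho sigma p q :
  cut_eulerian rho sigma -> kappabar_rho rho p q = kappabar_rho sigma p q.
Proof.
apply: (@count_cut_eulerian_eq _ _
  (fun x y => 0 <= x <= p%:Z /\ 0 <= y <= q%:Z) p%:Z q%:Z).
- by move=> x y [/andP[-> _] /andP[-> _]].
- by move=> x []; lia.
- by move=> x []; lia.
Qed.

End IntegerCounts.

(** * Tutte's lifting theorem *)

Section Lifting.
Variable G : multigraph.
Implicit Types (rho sigma eps : orientation G) (e : edge G) (v w a b : vertex G)
  (K : {set edge G}).

Lemma sum_excess eps (y : edge G -> int) (h : vertex G -> int) :
  \sum_v h v * (\sum_e y e * inc eps e v) =
  \sum_e y e * (h (head eps e) - h (tail eps e)).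
Proof.
under eq_bigr => v _ do rewrite big_distrr /=.
rewrite exchange_big; apply: eq_bigr => e _.
rewrite -(sum_inc eps e h) big_distrr /=.
by apply: eq_bigr => v _; rewrite mulrzz; ring.
Qed.

Section Tutte.
Variables (eps : orientation G) (q : int) (r : edge G -> int).
Hypothesis q_gt0 : 0 < q.
Hypothesis r_bound : forall e, 0 <= r e < q.

(** A nonzero residue has two lifts strictly between [-q] and [q]; [K] records where the negative
    one is taken. *)
Definition shifted K e : int := r e - q * (e \in K)%:Z.
Definition excess K v : int := \sum_e shifted K e * inc eps e v.
(** An arc from [a] to [b] stands for an edge whose toggling moves [q] units of excess from [a] to
    [b]. Zero residues are excluded, as their other lift [-q] is out of bounds. *)
Definition residual K : rel (vertex G) := fun a b =>
  [exists e, (r e != 0) &&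
    (if e \in K then (tail eps e == a) && (head eps e == b)
     else (head eps e == a) && (tail eps e == b))].
Definition total_excess K : int := \sum_v `|excess K v|.

Hypothesis q_excess : forall v, exists k : int, excess set0 v = k * q.

Lemma excess_dvd K v : exists k : int, excess K v = k * q.
Proof.
have [k kE] := q_excess v.
exists (k - \sum_e (e \in K)%:Z * inc eps e v); rewrite mulrBl -kE big_distrl.
rewrite /excess -sumrB; apply: eq_bigr => e _ /=.
by rewrite /shifted in_set0 /= mulr0; ring.
Qed.

Definition toggle e K := if e \in K then K :\ e else e |: K.

Lemma in_toggle e K e' : (e' \in toggle e K) = (e' \in K) (+) (e' == e).
Proof.
rewrite /toggle; case: ifP => eK; rewrite !inE.
  by case: eqP => [->|_]; rewrite ?eK ?addbF.
by case: eqP => [->|_]; rewrite ?eK ?addbF.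
Qed.

Lemma excess_toggle K e a b v :
  (if e \in K then (tail eps e == a) && (head eps e == b)
   else (head eps e == a) && (tail eps e == b)) ->
  excess (toggle e K) v = excess K v - q * (v == a)%:Z + q * (v == b)%:Z.
Proof.
move=> eab.
have E e' : e' != e -> shifted (toggle e K) e' = shifted K e'.
  by move=> e'e; rewrite /shifted in_toggle (negPf e'e) addbF.
rewrite /excess (bigD1 e) //= [in RHS](bigD1 e) //=.
rewrite (eq_bigr (fun e' => shifted K e' * inc eps e' v)); last first.
  by move=> e' /E ->.
rewrite /shifted in_toggle eqxx addbT /inc ![v == _]eq_sym.
by move: eab; case: (e \in K) => /andP[/eqP-> /eqP->] /=; ring.
Qed.

(** The only arc destroyed by toggling [e] is its own, which starts at [a]. *)
Lemma residual_toggle K e a b u w :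
  (if e \in K then (tail eps e == a) && (head eps e == b)
   else (head eps e == a) && (tail eps e == b)) ->
  u != a -> residual K u w -> residual (toggle e K) u w.
Proof.
move=> eab ua /existsP[e1 /andP[re1 uw]]; apply/existsP; exists e1.
rewrite re1 in_toggle; case: eqP => [e1E|_]; last by rewrite addbF.
move: uw; rewrite e1E addbT; move: eab.
by case: (e \in K) => /andP[/eqP-> _] /andP[/eqP au]; rewrite au eqxx in ua.
Qed.

(* Toggling the first edge of the path moves [q] units of excess one step
   along it, until they cancel against a deficit. *)
Lemma path_improvement p a K :
  {subset K <= [pred e | r e != 0]} -> path (residual K) a p -> uniq (a :: p) ->
  0 < excess K a -> excess K (last a p) < 0 ->
  exists K', {subset K' <= [pred e | r e != 0]} /\ total_excess K' < total_excess K.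
Proof.
elim: p a K => [|b p IH] a K sK /=; first by move=> _ _; lia.
move=> /andP[/existsP[e /andP[re eab]] pp] /andP[ap up] xa xl.
have ab : a != b by move: ap; rewrite inE negb_or => /andP[].
have sK' : {subset toggle e K <= [pred e | r e != 0]}.
  move=> e'; rewrite in_toggle inE; case: eqP => [->|_] //.
  by rewrite addbF => /sK.
have xE v := excess_toggle v eab.
have xE1 v : v != a -> v != b -> excess (toggle e K) v = excess K v.
  by move=> va vb; rewrite xE (negPf va) (negPf vb); lia.
have xEa : excess (toggle e K) a = excess K a - q.
  by rewrite xE eqxx (negPf ab); lia.
have xEb : excess (toggle e K) b = excess K b + q.
  by rewrite xE eqxx eq_sym (negPf ab); lia.
(* A positive multiple of [q] is at least [q]. *)
have xaq : q <= excess K a.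
  have [k kE] := excess_dvd K a; rewrite kE pmulr_lgt0 // in xa *.
  by rewrite -[X in X <= _]mul1r ler_pM2r //; lia.
pose rest := \sum_(v | (v != a) && (v != b)) `|excess K v|.
have tE : total_excess K = `|excess K a| + (`|excess K b| + rest).
  by rewrite /total_excess (bigD1 a) //= (bigD1 b) //= eq_sym.
have tE' : total_excess (toggle e K) = `|excess K a - q| + (`|excess K b + q| + rest).
  rewrite /total_excess (bigD1 a) //= (bigD1 b) /=; last by rewrite eq_sym.
  rewrite xEa xEb; congr (_ + (_ + _)); apply: eq_bigr => v /andP[va vb].
  by rewrite xE1.
have [xb|xb] := ltP (excess K b) 0.
  exists (toggle e K); split => //; rewrite tE tE'.
  have xbq : excess K b <= - q.
    have [k kE] := excess_dvd K b; rewrite kE pmulr_llt0 // in xb *.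
    by rewrite -mulN1r ler_pM2r //; lia.
  by lia.
(* Otherwise [b] has no deficit: the toggle keeps the total unchanged and makes the excess at [b]
   positive, so induction continues along the rest of the path, which avoids [a]. *)
have lb : last b p != b by apply: contraTneq xl => ->; rewrite -leNgt.
have la : last b p != a.
  by apply: contraNneq ap => <-; apply: mem_last.
have [|||K' [sK2 ltK']] := IH b (toggle e K) sK' _ up.
- apply: (sub_in_path (P := [pred u | u != a]) _ _ pp) => [u w ua _|].
    exact: residual_toggle eab ua.
  by apply/allP => u up' /=; apply: contraNneq ap => <-.
- by rewrite xEb; lia.
- by rewrite xE1.
exists K'; split=> //; apply: lt_le_trans ltK' _; rewrite tE tE'; lia.
Qed.

(** Take [K] minimising the total absolute excess. From a vertex of positive excess no deficit can
    be reached along residual arcs, so the reachable set has positive excess, which is contradicted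
    by counting over edges. Thus no excess is positive; as they sum to zero, all vanish. *)
Lemma zero_excess : exists2 K : {set edge G},
  {subset K <= [pred e | r e != 0]} & forall v, excess K v = 0.
Proof.
pose good K := K \subset [set e | r e != 0].
have good0 : good set0 by apply: sub0set.
have [K sK minK] := @arg_minnP _ set0 good (fun K => `|total_excess K|%N) good0.
have sK' : {subset K <= [pred e | r e != 0]}.
  by move=> e /(subsetP sK); rewrite !inE.
exists K => // v; suff {v} le0 v : excess K v <= 0.
  apply/eqP; rewrite -oppr_eq0.
  have /eqP : \sum_v - excess K v = 0.
    rewrite sumrN -[X in - X](_ : \sum_v 1 * excess K v = _); last first.
      by apply: eq_bigr => w _; rewrite mul1r.
    by rewrite sum_excess big1 ?oppr0 // => e _; rewrite subrr mulr0.
  rewrite psumr_eq0 => [/allP/(_ v (mem_index_enum v)) //|w _].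
  by rewrite oppr_ge0.
rewrite leNgt; apply/negP => v_gt0.
pose S := [set w | connect (residual K) v w].
have vS : v \in S by rewrite inE connect0.
have S_ge0 w : w \in S -> 0 <= excess K w.
  rewrite inE => /connectP[p pp ->]; rewrite leNgt; apply/negP => wlt0.
  move: wlt0; have [p' pp' up' _] := shortenP pp => wlt0.
  have [K' [sK2 ltK]] := path_improvement sK' pp' up' v_gt0 wlt0.
  have /minK : good K' by apply/subsetP => e /sK2; rewrite !inE.
  have t0 K1 : 0 <= total_excess K1 by apply: sumr_ge0.
  by have := t0 K; have := t0 K'; lia.
have Sstep a b : residual K a b -> a \in S -> b \in S.
  by rewrite !inE => ab va; apply: connect_trans va (connect1 ab).
(* The excess of [S] is positive when summed over vertices. Over edges it is nonpositive: no
   residual arc leaves [S], so a crossing edge has a lift at most zero if it enters [S] and at least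
   zero if it leaves. *)
have := sum_excess eps (shifted K) (fun w => (w \in S)%:Z).
apply/eqP; rewrite gt_eqF //; apply: (@le_lt_trans _ _ 0).
  apply: sumr_le0 => e _; have := r_bound e; rewrite /shifted.
  have Sfwd : e \in K -> tail eps e \in S -> head eps e \in S.
    move=> eK; apply: Sstep; apply/existsP; exists e.
    by have := sK' e eK; rewrite inE eK !eqxx => ->.
  have Sbwd : e \notin K -> r e != 0 -> head eps e \in S -> tail eps e \in S.
    move=> eK re; apply: Sstep; apply/existsP; exists e.
    by rewrite re (negPf eK) !eqxx.
  move: Sfwd Sbwd; case: (e \in K); case: (head eps e \in S); case: (tail eps e \in S);
    move=> fwd bwd; first [ lia | by have := fwd isT isT
    | by case: eqP bwd => [->|_]; [lia|move/(_ isT isT isT)] ].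
rewrite (bigD1 v) //= vS mul1r; apply: ltr_wpDr => //.
apply: sumr_ge0 => w _; case: (boolP (w \in S)) => [wS|_]; last by rewrite mul0r.
by rewrite mul1r S_ge0.
Qed.

End Tutte.
End Lifting.

(** * Reduction modulo p and q *)

Section Reduction.
Variable n : nat.
Local Notation p := n.+1%:Z.

(** As an integer multiple of a generator, the reduction is additive at once. *)
Definition red (x : int) : 'I_n.+1 := inZp 1 *~ x.

Lemma red_nat (k : nat) : red k = inZp k.
Proof.
rewrite /red -pmulrn Zp_mulrn; apply: val_inj => /=.
by rewrite modnMml mul1n.
Qed.

Lemma redK (a : 'I_n.+1) : red (a : nat) = a.
Proof. by rewrite red_nat valZpK. Qed.

Lemma redB x y : red (x - y) = red x - red y.
Proof. exact: mulrzBr. Qed.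

Lemma redD x y : red (x + y) = red x + red y.
Proof. exact: mulrzDr. Qed.

Lemma redM x y : red (x * y) = red x *~ y.
Proof. exact: mulrzA. Qed.

Lemma red0 : red 0 = 0. Proof. exact: mulr0z. Qed.

Lemma red_mul_mod k : red (k * p) = 0.
Proof.
have redp : red p = 0 by rewrite red_nat; apply: val_inj; rewrite /= modnn.
by rewrite mulrC redM redp mul0rz.
Qed.

Lemma red_eq0 x : red x = 0 <-> exists k : int, x = k * p.
Proof.
split=> [|[k ->]]; last exact: red_mul_mod.
have xE := divz_eq x p; have r0 : (0 <= x %% p)%Z by apply: modz_ge0.
have rp : (x %% p < p)%Z by apply: ltz_pmod.
move: r0 rp xE; case: (x %% p)%Z => // r _ rp xE.
rewrite xE redD red_mul_mod add0r red_nat => /(congr1 val) /=.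
rewrite modn_small // => ->; exists (x %/ p)%Z.
by rewrite addr0.
Qed.

Lemma red_eq x y : red x = red y <-> exists k : int, x = y + k * p.
Proof.
split=> [xy|[k ->]]; last by rewrite redD red_mul_mod addr0.
have /red_eq0[k kE] : red (x - y) = 0 by rewrite redB xy subrr.
by exists k; rewrite -kE addrC subrK.
Qed.

Lemma red_small_eq0 x : `|x| < p -> red x = 0 <-> x = 0.
Proof.
move=> xp; split=> [/red_eq0[k xE]|->]; last exact: red0.
have [k0|k0] := eqVneq k 0; first by rewrite xE k0 mul0r.
have px : p <= `|x| by rewrite xE normrM ler_peMl //; lia.
by have := le_lt_trans px xp; rewrite ltxx.
Qed.

Variables (G : multigraph) (eps : orientation G).
Implicit Types (F : {ffun edge G -> int}) (f : {ffun edge G -> 'I_n.+1}).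

Definition red_fun F : {ffun edge G -> 'I_n.+1} := [ffun e => red (F e)].

Lemma tension_red F : is_tension eps F -> is_tension eps (red_fun F).
Proof.
move=> [h hE]; exists [ffun v => red (h v)] => e.
by rewrite !ffunE hE redB.
Qed.

Lemma flow_red F : is_flow eps F -> is_flow eps (red_fun F).
Proof.
move=> /is_flow_intE H; apply/is_flowE => v.
under eq_bigr => e _ do rewrite ffunE -redM.
by rewrite /red -mulrz_sumr H mulr0z.
Qed.

(** Lift the potential to values in [0, p): differences stay below [p] in absolute value. *)
Lemma tension_lift f : is_tension eps f ->
  exists F, [/\ is_tension eps F, forall e, `|F e| < p & red_fun F = f].
Proof.
move=> [h hE]; pose hZ := [ffun v => (h v : nat)%:Z].
exists [ffun e => hZ (tail eps e) - hZ (head eps e)]; split.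
- by exists hZ => e; rewrite ffunE.
- move=> e; rewrite !ffunE.
  by have := ltn_ord (h (tail eps e)); have := ltn_ord (h (head eps e)); lia.
- by apply/ffunP => e; rewrite !ffunE redB !redK hE.
Qed.

(** The representatives in [0, p) have excess divisible by [p] at each vertex; [zero_excess] selects
    the edges from which to subtract [p]. *)
Lemma flow_lift f : is_flow eps f ->
  exists F, [/\ is_flow eps F, forall e, `|F e| < p & red_fun F = f].
Proof.
move=> /is_flowE H; pose r e : int := (f e : nat).
have r_bound e : 0 <= r e < p by rewrite /r; have := ltn_ord (f e); lia.
have [||K sK K0] := @zero_excess G eps p r _ r_bound; first by [].
  move=> v; apply/red_eq0; rewrite -[RHS](H v) /excess /red mulrz_sumr.
  apply: eq_bigr => e _; rewrite -/(red _) redM /shifted in_set0 mulr0 subr0.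
  by rewrite redK.
exists [ffun e => shifted p r K e]; split.
- by apply/is_flow_intE => v; rewrite -[RHS](K0 v); apply: eq_bigr => e _; rewrite ffunE.
- move=> e; rewrite ffunE /shifted; have := r_bound e; have := sK e; rewrite inE.
  by case: (e \in K) => [/(_ isT)|_]; lia.
- apply/ffunP => e; rewrite !ffunE redB mulrC red_mul_mod subr0.
  exact: redK.
Qed.

End Reduction.

(** * Fibres of the reduction: one lift for each orientation of a class *)

Section Fibers.
Variables (G : multigraph) (eps : orientation G).
Local Notation efun := {ffun edge G -> int}.

(** The sign of [x] where the orientation changes: [x - p * jump true x] is the other lift of a
    nonzero residue in the open interval (-p, p). *)
Definition jump (b : bool) (x : int) : int :=
  if b then (if 0 < x then 1 else if x < 0 then -1 else 0) else 0.

Lemma nz_pair_jump p q x y b : nz_pair p q x y ->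
  nz_pair p q (x - p * jump b x) (y - q * jump b y) /\
  (0 < (x - p * jump b x) + (y - q * jump b y)) = (0 < x + y) (+) b.
Proof.
rewrite /jump => -[/mulz_eq0 xy0 xyN0 xp yq].
case: b; last by rewrite !mulr0 !subr0 addbF; split=> //; split=> //; apply/mulz_eq0.
rewrite addbT; case: (ltgtP x 0) xy0 xyN0 xp => x0; case: (ltgtP y 0) yq => y0 *;
  by split; [split; [apply/mulz_eq0|..]|]; lia.
Qed.

Lemma mod_bound (p x y k : int) :
  `|x| < p -> `|y| < p -> x = y + k * p -> [\/ k = 0, k = 1 | k = -1].
Proof.
move=> xp yp xE; have k2 : k < 2 by rewrite ltNge; apply/negP; nia.
have k2' : -2 < k by rewrite ltNge; apply/negP; nia.
have [->|k0] := eqVneq k 0; first by constructor 1.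
have [k_gt0|k_le0] := ltP 0 k; [constructor 2|constructor 3]; lia.
Qed.

(** The two lifts of a nonzero residue have opposite signs, and zero lifts only to zero; the sign of
    the pair therefore determines it. *)
Lemma nz_pair_congr p q x0 y0 x y k l :
  nz_pair p q x0 y0 -> nz_pair p q x y -> x = x0 + k * p -> y = y0 + l * q ->
  let b := (0 < x + y) != (0 < x0 + y0) in
  x = x0 - p * jump b x0 /\ y = y0 - q * jump b y0.
Proof.
move=> [/mulz_eq0 xy00 xyN00 xp0 yq0] [/mulz_eq0 xy0 xyN0 xp yq] xE yE b.
rewrite {}/b /jump.
have kE := mod_bound xp xp0 xE; have lE := mod_bound yq yq0 yE.
case: (ltP 0 (x + y)) => xy; case: (ltP 0 (x0 + y0)) => xy';
  case: (ltgtP x0 0) => x0'; case: (ltgtP y0 0) => y0' /=;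
  by case: kE xE => ->; case: lE yE => ->; lia.
Qed.

Lemma tension_unscale (p : int) (t : efun) : 0 < p ->
  is_tension eps [ffun e => p * t e + 0 * t e] -> is_tension eps t.
Proof.
(* Along each edge [h] changes by a multiple of [p], so the rounding errors of the division
   cancel. *)
move=> p0 [h hE]; exists [ffun v => (h v %/ p)%Z] => e; rewrite !ffunE.
have := hE e; rewrite ffunE mul0r addr0 => {}hE.
have -> : h (tail eps e) = t e * p + h (head eps e) by rewrite mulrC hE subrK.
by rewrite divzMDl ?gt_eqF // addrK.
Qed.

Lemma flow_unscale (p : int) (t : efun) : 0 < p ->
  is_flow eps [ffun e => p * t e + 0 * t e] -> is_flow eps t.
Proof.
move=> p0 /is_flow_intE H; apply/is_flow_intE => v.
have p1 : p != 0 by rewrite gt_eqF.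
apply: (mulfI p1); rewrite mulr0 -[RHS](H v) big_distrr.
by apply: eq_bigr => e _ /=; rewrite ffunE; ring.
Qed.

Section Fiber.
Variables (n m : nat) (fg0 : efun * efun).
Local Notation p := n.+1%:Z.
Local Notation q := m.+1%:Z.
Hypothesis fg0P : nz_pairs eps n.+1 m.+1 fg0.

Definition red_pair (fg : efun * efun) := (red_fun n fg.1, red_fun m fg.2).

Let rho0 := sign_orientation eps fg0.

(** Inverse of [sign_orientation] on the fibre: pass to the other lift exactly where [sigma] differs
    from [rho0]. *)
Definition jump_pair (sigma : orientation G) : efun * efun :=
  ([ffun e => fg0.1 e - p * jump (rho0 e != sigma e) (fg0.1 e)],
   [ffun e => fg0.2 e - q * jump (rho0 e != sigma e) (fg0.2 e)]).

Lemma sign_orientation_diff fg e :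
  (rho0 e != sign_orientation eps fg e) =
  ((0 < fg.1 e + fg.2 e) != (0 < fg0.1 e + fg0.2 e)).
Proof.
by rewrite !ffunE; case: (eps e); case: (0 < fg.1 e + fg.2 e); case: (0 < _).
Qed.

(** In the orientation [rho0] the pair is positive, so orthogonality makes its tension vanish on [D]
    and its flow on [C]; the jumps are then the indicators of [C] and [D], flipped back to [eps]. *)
Lemma jump_tension_flow sigma : cut_eulerian rho0 sigma ->
  is_tension eps [ffun e => jump (rho0 e != sigma e) (fg0.1 e)] /\
  is_flow eps [ffun e => jump (rho0 e != sigma e) (fg0.2 e)].
Proof.
case/cut_eulerian_ind => C [D [tC uD CDE]]; have [tf ug H] := fg0P.
pose f' := flip eps rho0 fg0.1; pose g' := flip eps rho0 fg0.2.
have pos e : pos_pair p q (f' e) (g' e).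
  rewrite !ffunE; apply: nz_pair_sign (H e) _.
  by rewrite leNgt; case: (eps e); case: (0 < _).
have f0 e : 0 <= f' e by have [_ _ /andP[]] := pos e.
have g0 e : 0 <= g' e by have [_ _ _ /andP[]] := pos e.
have i0 (X : {set edge G}) e : 0 <= ind X e by rewrite ffunE.
have dD := nonneg_disjoint_support (tension_flip rho0 tf) uD f0 (i0 D).
have dC := nonneg_disjoint_support tC (flow_flip rho0 ug) (i0 C) g0.
have E e : jump (rho0 e != sigma e) (fg0.1 e) = flip rho0 eps (ind C) e /\
           jump (rho0 e != sigma e) (fg0.2 e) = flip rho0 eps (ind D) e.
  have := dC e; have := dD e; have := CDE e; have [/mulz_eq0] := H e.
  rewrite !(ffunE, signzE) /=; move: (fg0.1 e) (fg0.2 e) => x y.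
  have -> : ((eps e == (0 < x + y)) != eps e) = ~~ (0 < x + y).
    by case: (eps e); case: (0 < _).
  have -> : (eps e != (eps e == (0 < x + y))) = ~~ (0 < x + y).
    by case: (eps e); case: (0 < _).
  rewrite /jump; case: (e \in C); case: (e \in D); case: (_ != sigma e) => //=;
  case: (ltP 0 (x + y)) => /=; case: (ltgtP x 0); case: (ltgtP y 0); lia.
split.
  suff -> : [ffun e => jump (rho0 e != sigma e) (fg0.1 e)] = flip rho0 eps (ind C).
    exact: tension_flip.
  by apply/ffunP => e; rewrite ffunE; have [] := E e.
suff -> : [ffun e => jump (rho0 e != sigma e) (fg0.2 e)] = flip rho0 eps (ind D).
  exact: flow_flip.
by apply/ffunP => e; rewrite ffunE; have [] := E e.
Qed.

(** Two lifts differ by [p] times a tension and [q] times a flow; seen from [rho0], these two add up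
    to the indicator of the edges whose sign changes, so sign orientations stay in the class.
    [jump_pair] gives the inverse. *)
Lemma card_fiber :
  #|` fset_set (fun fg => nz_pairs eps n.+1 m.+1 fg /\ red_pair fg = red_pair fg0)|
  = #|ce_class rho0|.
Proof.
have [tf0 ug0 H0] := fg0P.
have jumpE fg : nz_pairs eps n.+1 m.+1 fg -> red_pair fg = red_pair fg0 ->
    forall e, let b := rho0 e != sign_orientation eps fg e in
      fg.1 e = fg0.1 e - p * jump b (fg0.1 e) /\
      fg.2 e = fg0.2 e - q * jump b (fg0.2 e).
  move=> [tf ug H] [/ffunP E1 /ffunP E2] e; rewrite sign_orientation_diff.
  have := E1 e; rewrite !ffunE => /red_eq[k kE].
  have := E2 e; rewrite !ffunE => /red_eq[l lE].
  exact: nz_pair_congr (H0 e) (H e) kE lE.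
have -> : #|ce_class rho0| = #|[set sigma | `[< cut_eulerian rho0 sigma >]]|.
  by apply: eq_card => sigma; rewrite !inE asboolb.
rewrite -card_fset_set_finType.
apply: (@card_fset_set_bij _ _ _ _ (sign_orientation eps) jump_pair).
- move=> fg [fgP fgE]; have [tf ug H] := fgP.
  pose t : efun := [ffun e => jump (rho0 e != sign_orientation eps fg e) (fg0.1 e)].
  pose u : efun := [ffun e => jump (rho0 e != sign_orientation eps fg e) (fg0.2 e)].
  apply/cut_eulerianP; exists (flip eps rho0 t), (flip eps rho0 u); split.
  + apply/tension_flip/(@tension_unscale p) => //.
    suff -> : [ffun e => p * t e + 0 * t e] = [ffun e => 1 * fg0.1 e + (-1) * fg.1 e].
      exact: tension_lin.
    apply/ffunP => e; have [fE _] := jumpE _ fgP fgE e.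
    by rewrite [LHS]ffunE [RHS]ffunE fE [t e]ffunE; ring.
  + apply/flow_flip/(@flow_unscale q) => //.
    suff -> : [ffun e => q * u e + 0 * u e] = [ffun e => 1 * fg0.2 e + (-1) * fg.2 e].
      exact: flow_lin.
    apply/ffunP => e; have [_ gE] := jumpE _ fgP fgE e.
    by rewrite [LHS]ffunE [RHS]ffunE gE [u e]ffunE; ring.
  + move=> e; rewrite !(ffunE, signzE) /=; have [/mulz_eq0] := H0 e.
    move: (fg0.1 e) (fg0.2 e) => x y.
    have -> : (eps e != (eps e == (0 < x + y))) = ~~ (0 < x + y).
      by case: (eps e); case: (0 < _).
    rewrite /jump; case: (_ != (_ == (0 < fg.1 e + _))) => //=;
    case: (ltP 0 (x + y)) => /=; case: (ltgtP x 0); case: (ltgtP y 0); lia.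
- move=> sigma /jump_tension_flow[tj uj]; split; first split=> /=.
  + have := tension_lin 1 (- p) tf0 tj; congr is_tension.
    by apply/ffunP => e; rewrite !ffunE; ring.
  + have := flow_lin 1 (- q) ug0 uj; congr is_flow.
    by apply/ffunP => e; rewrite !ffunE; ring.
  + move=> e; rewrite /= ffunE [X in nz_pair _ _ _ X]ffunE.
    by have [] := nz_pair_jump (rho0 e != sigma e) (H0 e).
  + congr (_, _); apply/ffunP => e;
    by rewrite !ffunE redB mulrC red_mul_mod subr0.
- move=> [f g] [fgP fgE]; congr (_, _); apply/ffunP => e;
  by rewrite [LHS]ffunE; have [] := jumpE _ fgP fgE e.
- move=> sigma _; apply/ffunP => e; rewrite [LHS]ffunE /=.
  rewrite [X in X + _]ffunE [X in _ + X]ffunE.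
  have [_ ->] := nz_pair_jump (rho0 e != sigma e) (H0 e).
  by rewrite !ffunE; case: (eps e); case: (0 < _); case: (sigma e).
Qed.

End Fiber.

Lemma kappaZ_cyclic (n m c : nat) :
  (forall rho : orientation G, #|ce_class rho| = c) ->
  kappaZ eps n.+1 m.+1 = (c * kappa eps 'I_n.+1 'I_m.+1)%N.
Proof.
move=> cE; rewrite kappaZE /kappa /count_tension_flows.
rewrite (card_fset_set_fibers (@red_pair n m)); last exact: nz_pairs_finite.
rewrite card_fset_set_finType.
(* Reductions counted by [kappa] have a lift, hence a fibre of size [c]; all others have an empty
   fibre. *)
set S := [set x | _]; rewrite (bigID (mem S)) /= [X in (_ + X)%N]big1.
  rewrite addn0 mulnC -sum_nat_const; apply: eq_bigr => -[f g].
  rewrite inE => /asboolP[/= tf ug fgE].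
  have [F [tF Fp FE]] := tension_lift tf; have [H [uH Hq HE]] := flow_lift ug.
  (* By the bounds, a lift vanishes exactly where its residue does, so the supports remain
     complementary. *)
  have FH0 e : (F e == 0) = (H e != 0).
    have /setP/(_ e) := fgE; rewrite !inE -FE -HE !ffunE => E.
    apply/eqP/idP => [F0|].
      by apply/eqP => H0; move: E; rewrite F0 H0 !red0 !eqxx.
    move=> H0; apply/(red_small_eq0 (Fp e))/eqP; rewrite E.
    by apply: contraNneq H0 => /(red_small_eq0 (Hq e)) ->.
  have FHP : nz_pairs eps n.+1 m.+1 (F, H).
    split=> // e /=; have := FH0 e.
    have [F0 /esym H0|F0 /esym/negbFE/eqP H0] := eqVneq (F e) 0.
      by split; rewrite ?F0 ?mul0r ?add0r.
    by split; rewrite ?H0 ?mulr0 ?addr0.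
  rewrite -(cE (sign_orientation eps (F, H))) -(card_fiber FHP).
  by rewrite /red_pair /= FE HE.
move=> fg; apply: contraNeq; rewrite -lt0n cardfs_gt0 => /fset0Pn[FH].
case/in_fset_setP; first by apply: sub_finite_set (nz_pairs_finite eps n.+1 m.+1) => x [].
move=> [tF uH FHP] <-; rewrite inE; apply/asboolP; split=> /=.
- exact: tension_red.
- exact: flow_red.
- apply/setP => e; rewrite !inE !ffunE; have [/mulz_eq0 FH0 FHN0 Fp Hq] := FHP e.
  apply/eqP/idP => [/(red_small_eq0 Fp) F0|H0].
    by apply/eqP => /(red_small_eq0 Hq) H0; move: FHN0; rewrite F0 H0.
  by apply/(red_small_eq0 Fp); case: FH0 => // Z; rewrite Z red0 eqxx in H0.
Qed.

End Fibers.

(** * Independence of the groups *)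

Section GroupIndependence.
Variables (G : multigraph) (eps : orientation G).
Implicit Types (A B : finZmodType) (X Y : {set edge G}) (e : edge G).

Definition tensions A X : {set {ffun edge G -> A}} :=
  [set f | `[< is_tension eps f >] && (ker_edges f == X)].

Definition nz_flows B X : {set {ffun edge G -> B}} :=
  [set g | `[< is_flow eps g >] && (supp_edges g == X)].

Lemma kappa_sum A B :
  kappa eps A B = (\sum_X #|tensions A X| * #|nz_flows B X|)%N.
Proof.
rewrite /kappa /count_tension_flows card_fset_set_finType.
rewrite -sum1_card (partition_big (fun fg => ker_edges fg.1) xpredT) //=.
apply: eq_bigr => X _; rewrite -cardsX -sum1_card; apply: eq_bigl => -[f g].
rewrite !inE /=; apply/andP/andP.
  case=> /asboolP[/= tf ug fg] /eqP fX.
  by rewrite -fX fg !eqxx !andbT; split; apply/asboolP.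
case=> /andP[/asboolP tf /eqP fX] /andP[/asboolP ug /eqP gX].
by split; [apply/asboolP; split=> //=; rewrite fX gX|apply/eqP].
Qed.

Definition potentials A X : {set {ffun vertex G -> A}} :=
  [set h : {ffun vertex G -> A} |
    [forall e, (h (tail eps e) == h (head eps e)) == (e \in X)]].

(** The potentials of one tension form a coset of those constant along every edge, which are the
    potentials for the full edge set. *)
Lemma card_potentials A X :
  #|potentials A X| = (#|tensions A X| * #|potentials A [set: edge G]|)%N.
Proof.
pose delta (h : {ffun vertex G -> A}) : {ffun edge G -> A} :=
  [ffun e => h (tail eps e) - h (head eps e)].
have ker_delta h : ker_edges (delta h) = X <-> h \in potentials A X.
  rewrite inE; split=> [/setP E|/forallP E].
    by apply/forallP => e; rewrite -(E e) inE ffunE subr_eq0.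
  by apply/setP => e; rewrite inE ffunE subr_eq0 (eqP (E e)).
rewrite -sum1_card (partition_big delta (mem (tensions A X))) /=; last first.
  move=> h /ker_delta <-; rewrite inE eqxx andbT; apply/asboolP.
  by exists h => e; rewrite ffunE.
rewrite -sum_nat_const; apply: eq_bigr => f; rewrite inE => /andP[/asboolP[h0 fE]].
move=> /eqP fX; have {}fE : f = delta h0 by apply/ffunP => e; rewrite ffunE fE.
rewrite (reindex_inj (addrI h0)) /= sum1dep_card; apply: eq_card => h.
have deltaD : delta (h0 + h) = delta h0 + delta h.
  by apply/ffunP => e; rewrite !ffunE opprD addrACA.
rewrite inE fE deltaD -[X in _ == X]addr0 (inj_eq (addrI _)).
apply/andP/idP => [[_ /eqP/ffunP h_0]|].
  rewrite inE; apply/forallP => e; rewrite in_setT eqb_id.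
  by apply/eqP/subr0_eq; have := h_0 e; rewrite !ffunE.
rewrite inE => /forallP hT; have d0 : delta h = 0.
  apply/ffunP => e; have := hT e.
  by rewrite in_setT eqb_id !ffunE => /eqP->; rewrite subrr.
by split; rewrite ?d0 //; apply/ker_delta; rewrite deltaD d0 addr0 -fE.
Qed.

(** Membership only compares values for equality, so any injection of the underlying sets transports
    potentials. *)
Lemma leq_card_potentials A A' X :
  (#|A| <= #|A'|)%N -> (#|potentials A X| <= #|potentials A' X|)%N.
Proof.
move=> le; pose phi (a : A) : A' := enum_val (widen_ord le (enum_rank a)).
have phi_inj : injective phi.
  move=> a b /enum_val_inj/(congr1 val) /= ab.
  by apply: enum_rank_inj; apply: val_inj.
pose lift_phi (h : {ffun vertex G -> A}) := [ffun v => phi (h v)].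
have lift_inj : injective lift_phi.
  by move=> h k /ffunP E; apply/ffunP => v; have := E v; rewrite !ffunE => /phi_inj.
rewrite -(card_imset _ lift_inj); apply/subset_leq_card/subsetP => _ /imsetP[h hX ->].
move: hX; rewrite !inE => /forallP hX; apply/forallP => e.
by rewrite !ffunE (inj_eq phi_inj).
Qed.

Lemma card_tensions_eq A A' X :
  #|A| = #|A'| -> #|tensions A X| = #|tensions A' X|.
Proof.
move=> AA'; have P Y : #|potentials A Y| = #|potentials A' Y|.
  by apply/eqP; rewrite eqn_leq !leq_card_potentials ?AA'.
apply/eqP; rewrite -(@eqn_pmul2r #|potentials A [set: edge G]|).
  by rewrite -card_potentials P [X in (_ * X)%N]P -card_potentials.
apply/card_gt0P; exists 0; rewrite inE; apply/forallP => e.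
by rewrite !ffunE eqxx inE.
Qed.

Definition flows B X : {set {ffun edge G -> B}} :=
  [set g | `[< is_flow eps g >] && (supp_edges g \subset X)].

(* [S] collects the ends of the walks that start at the head of [e] and use
   edges of [Y] only; a walk is recorded by the integer chain that it carries. *)
Lemma flow_cycle_or_cut Y e : e \notin Y ->
  (exists c : {ffun edge G -> int},
     [/\ is_flow eps c, c e = 1 & forall e', e' \notin e |: Y -> c e' = 0]) \/
  (exists S : {set vertex G}, [/\ head eps e \in S, tail eps e \notin S &
     forall e', e' \in Y -> (tail eps e' \in S) = (head eps e' \in S)]).
Proof.
move=> eY; pose walk w (c : {ffun edge G -> int}) :=
  (forall e', e' \notin Y -> c e' = 0) /\
  forall v, \sum_e' c e' * inc eps e' v = (v == w)%:Z - (v == head eps e)%:Z.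
pose S := [set w | `[< exists c, walk w c >]].
have sum_delta e1 v : \sum_e' (e' == e1)%:Z * inc eps e' v = inc eps e1 v.
  rewrite (bigD1 e1) //= eqxx mul1r big1 ?addr0 // => e2 /negPf ->.
  by rewrite mul0r.
have walkD w w' (a : int) e1 c : e1 \in Y -> walk w c ->
    (forall v, a * inc eps e1 v = (v == w')%:Z - (v == w)%:Z) ->
    walk w' [ffun e' => c e' + a * (e' == e1)%:Z].
  move=> e1Y [c0 cE] aE; split=> [e' e'Y|v].
    by rewrite ffunE c0 //; case: eqP => [e'E|_];
      [rewrite e'E e1Y in e'Y|rewrite mulr0 addr0].
  transitivity (\sum_e' c e' * inc eps e' v + a * \sum_e' (e' == e1)%:Z * inc eps e' v).
    rewrite big_distrr -big_split; apply: eq_bigr => e' _ /=.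
    by rewrite ffunE mulrDl mulrA.
  by rewrite sum_delta cE aE; ring.
have hS : head eps e \in S.
  rewrite inE; apply/asboolP; exists [ffun=> 0]; split=> [e' _|v].
    by rewrite ffunE.
  by rewrite subrr big1 // => e' _; rewrite ffunE mul0r.
have SY e' : e' \in Y -> (tail eps e' \in S) = (head eps e' \in S).
  move=> e'Y; rewrite !inE; apply/asboolP/asboolP => -[c cw].
    exists [ffun e1 => c e1 + 1 * (e1 == e')%:Z]; apply: walkD cw _ => // v.
    by rewrite /inc ![v == _]eq_sym mul1r.
  exists [ffun e1 => c e1 + (-1) * (e1 == e')%:Z]; apply: walkD cw _ => // v.
  by rewrite /inc ![v == _]eq_sym; lia.
have [tS|tS] := boolP (tail eps e \in S); [left|by right; exists S].
(* A walk from the head of [e] to its tail is closed into a cycle by [e]. *)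
move: tS; rewrite inE => /asboolP[c [c0 cE]].
exists [ffun e' => c e' + (e' == e)%:Z]; split.
- apply/is_flow_intE => v.
  transitivity (\sum_e' c e' * inc eps e' v + \sum_e' (e' == e)%:Z * inc eps e' v).
    by rewrite -big_split; apply: eq_bigr => e' _; rewrite ffunE mulrDl.
  by rewrite sum_delta cE /inc ![v == _]eq_sym; lia.
- by rewrite ffunE eqxx c0.
- by move=> e'; rewrite !inE negb_or ffunE => /andP[/negPf-> /c0->].
Qed.

(** The net flow into [S] is zero, and [e] alone can contribute to it. *)
Lemma flows_cut_eq0 B (S : {set vertex G}) (g : {ffun edge G -> B}) e :
  is_flow eps g -> head eps e \in S -> tail eps e \notin S ->
  (forall e', e' != e -> g e' != 0 -> (tail eps e' \in S) = (head eps e' \in S)) ->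
  g e = 0.
Proof.
move=> /is_flowE ug hS tS gS.
have : \sum_v (\sum_e' g e' *~ inc eps e' v) *~ (v \in S)%:Z = 0.
  by rewrite big1 // => v _; rewrite ug mul0rz.
under eq_bigr => v _ do rewrite mulrz_suml.
rewrite exchange_big (bigD1 e) //= [X in _ + X]big1 ?addr0.
  under eq_bigr => v _ do rewrite -mulrzA mulrC mulrzA.
  by rewrite sum_inc hS (negPf tS) mulr0z subr0.
move=> e' e'e; under eq_bigr => v _ do rewrite -mulrzA mulrC mulrzA.
rewrite sum_inc; have [->|ge'] := eqVneq (g e') 0; first by rewrite !mul0rz subrr.
by rewrite gS ?subrr.
Qed.

(** If [e] lies on a cycle chain [c], subtracting [g e] times [c] splits off a free value in [B]; if
    a cut separates its ends, [g e] is forced to be zero. Which case occurs depends on the graph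
    alone, so [b] is chosen before [B]. *)
Lemma card_flows_step Y e : e \notin Y ->
  exists b : bool, forall B : finZmodType,
    #|flows B (e |: Y)| = (#|B| ^ b * #|flows B Y|)%N.
Proof.
move=> eY; have [[c [uc c1 c0]]|[S [hS tS SY]]] := flow_cycle_or_cut eY; last first.
  exists false => B; rewrite mul1n; apply: eq_card => g; rewrite !inE.
  apply: andb_id2l => /asboolP ug; apply/idP/idP => gY; last first.
    exact: subset_trans gY (subsetUr _ _).
  have ge : g e = 0.
    apply: flows_cut_eq0 ug hS tS _ => e' e'e ge'; apply: SY.
    by have /subsetP/(_ e') := gY; rewrite !inE (negPf e'e) => /(_ ge').
  apply/subsetP => e' ge'; have := subsetP gY e' ge'; rewrite !inE.
  by case: eqP => // e'E; move: ge'; rewrite inE e'E ge eqxx.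
exists true => B.
pose shift (x : B * {ffun edge G -> B}) : {ffun edge G -> B} :=
  [ffun e' => x.2 e' + x.1 *~ c e'].
have shift_flow b g : is_flow eps g -> is_flow eps (shift (b, g)).
  move=> /is_flowE ug; apply/is_flowE => v.
  transitivity (\sum_e' g e' *~ inc eps e' v + b *~ \sum_e' c e' * inc eps e' v).
    rewrite mulrz_sumr -big_split; apply: eq_bigr => e' _.
    by rewrite ffunE mulrzDl mulrzA.
  by move/is_flow_intE: uc => ->; rewrite ug mulr0z addr0.
have flow_e g : g \in flows B Y -> g e = 0.
  rewrite inE => /andP[_ /subsetP/(_ e)]; rewrite (negPf eY) inE => H.
  by apply/eqP; apply: contraT => /H.
have shift_inj : {in setX [set: B] (flows B Y) &, injective shift}.
  move=> [b g] [b' g']; rewrite !in_setX /= => /andP[_ gY] /andP[_ gY'] /ffunP E.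
  have bb' : b = b'.
    by have := E e; rewrite !ffunE /= !flow_e // !add0r c1.
  by congr (_, _) => //; apply/ffunP => e'; have := E e'; rewrite !ffunE bb' => /addIr.
rewrite expn1 -cardsT -cardsX -(card_in_imset shift_inj).
apply: eq_card => g; apply/idP/imsetP => [|[[b g0]]].
  rewrite inE => /andP[/asboolP ug gY].
  exists (g e, shift (- g e, g)); last first.
    by apply/ffunP => e'; rewrite !ffunE /= mulNrz subrK.
  rewrite in_setX in_setT inE /=; apply/andP; split; first exact/asboolP/shift_flow.
  apply/subsetP => e'; rewrite inE ffunE /= mulNrz; apply: contraR => e'Y.
  have [->|e'e] := eqVneq e' e; first by rewrite c1 mulr1z subrr.
  have e'eY : e' \notin e |: Y by rewrite !inE negb_or e'e.
  rewrite c0 // mulr0z subr0; apply: contraR e'eY => ge'.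
  by apply: (subsetP gY); rewrite inE.
rewrite in_setX in_setT !inE /= => /andP[/asboolP ug0 gY] ->.
apply/andP; split; first exact/asboolP/shift_flow.
apply/subsetP => e'; rewrite inE ffunE /=; apply: contraR => e'Y.
rewrite c0 // mulr0z addr0; apply: contraR e'Y => ge'.
by rewrite !inE (subsetP gY) ?orbT // inE.
Qed.

Lemma card_flows_eq B B' X : #|B| = #|B'| -> #|flows B X| = #|flows B' X|.
Proof.
move=> BB'; elim: {X}#|X| {-2}X (erefl #|X|) => [|k IH] X.
  move/eqP; rewrite cards_eq0 => /eqP->.
  have E (C : finZmodType) : flows C set0 = [set [ffun=> 0]].
    apply/setP => g; rewrite !inE; apply/andP/eqP => [[_ /subsetP g0]|->].
      by apply/ffunP => e; rewrite ffunE; apply/eqP; apply: contraT => ge;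
        have := g0 e; rewrite !inE => /(_ ge).
    split; last by apply/subsetP => e; rewrite !inE ffunE eqxx.
    by apply/asboolP/is_flowE => v; rewrite big1 // => e _; rewrite ffunE mul0rz.
  by rewrite !E !cards1.
move=> Xk; have [|e eX] := set0Pn X _; first by rewrite -cards_eq0 Xk.
have [|b bE] := @card_flows_step (X :\ e) e; first by rewrite !inE eqxx.
rewrite -(setD1K eX) !bE BB' IH //.
by move: Xk; rewrite (cardsD1 e) eX => -[].
Qed.

Lemma card_flows_sum B X :
  #|flows B X| = (\sum_(Y : {set edge G} | Y \subset X) #|nz_flows B Y|)%N.
Proof.
rewrite -sum1_card (partition_big (@supp_edges G B) (fun Y => Y \subset X)); last first.
  by move=> g; rewrite inE => /andP[].
apply: eq_bigr => Y YX; rewrite -sum1_card; apply: eq_bigl => g; rewrite !inE.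
by case: eqP => [->|_]; rewrite ?andbF // YX !andbT.
Qed.

(** Sort the flows supported in [X] by exact support: by induction the terms of proper subsets agree
    and cancel. *)
Lemma card_nz_flows_eq B B' X : #|B| = #|B'| -> #|nz_flows B X| = #|nz_flows B' X|.
Proof.
move=> BB'; elim: {X}_.+1 {-2}X (ltnSn #|X|) => // k IH X; rewrite ltnS => Xk.
have := card_flows_eq X BB'; rewrite !card_flows_sum.
rewrite (bigD1 X) //= [in RHS](bigD1 X) //=.
rewrite (eq_bigr (fun Y => #|nz_flows B' Y|)) => [/addIn //|Y YX].
by apply: IH; apply: leq_trans (proper_card _) Xk; rewrite properEneq andbC.
Qed.

Lemma kappa_card_eq A A' B B' :
  #|A| = #|A'| -> #|B| = #|B'| -> kappa eps A B = kappa eps A' B'.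
Proof.
move=> AA' BB'; rewrite !kappa_sum; apply: eq_bigr => X _.
by rewrite (card_tensions_eq X AA') (card_nz_flows_eq X BB').
Qed.

Lemma kappaZ_modular A B (c : nat) :
  (forall rho : orientation G, #|ce_class rho| = c) ->
  kappaZ eps #|A| #|B| = (c * kappa eps A B)%N.
Proof.
move=> cE; have A0 : (0 < #|A|)%N by apply/card_gt0P; exists 0.
have B0 : (0 < #|B|)%N by apply/card_gt0P; exists 0.
rewrite (@kappa_card_eq A 'I_#|A|.-1.+1 B 'I_#|B|.-1.+1) ?card_ord ?prednK //.
by rewrite -kappaZ_cyclic // !prednK.
Qed.

End GroupIndependence.

(** * From counts to polynomials *)

Lemma poly_eq_on_naturals (R : idomainType) (x : nat -> R) (P Q : {poly R}) :
  injective x -> (forall n, P.[x n] = Q.[x n]) -> P = Q.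
Proof.
move=> x_inj PQ; apply/subr0_eq; apply/eqP; apply: contraT => D0.
pose s := [seq x i | i <- iota 0 (size (P - Q))].
have := max_poly_roots D0 (_ : all (root (P - Q)) s) (_ : uniq s).
rewrite size_map size_iota ltnn; apply.
  by apply/allP => _ /mapP[i _ ->]; rewrite /root hornerD hornerN PQ subrr.
by rewrite map_inj_uniq ?iota_uniq.
Qed.

Lemma agrees_unique (P Q : {poly {poly rat}}) (F : nat -> nat -> nat) :
  agrees P F -> agrees Q F -> P = Q.
Proof.
(* Agreement is required at positive integers only, hence the successors. The outer variable is
   specialised first, at constant polynomials. *)
move=> PF QF; have inj : injective (fun n => n.+1%:R : rat).
  by move=> a b /eqP; rewrite eqr_nat => /eqP[].
apply: (@poly_eq_on_naturals _ (fun n => (n.+1%:R)%:P)) => [a b /polyC_inj/inj //|a].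
apply: (poly_eq_on_naturals inj) => b; rewrite -[LHS]/(P.[_, _]) -[RHS]/(Q.[_, _]).
by rewrite PF // QF.
Qed.

Theorem theorem4p9 (G : multigraph) (eps : orientation G)
    (rep : {set orientation G} -> orientation G)
    (rep_class : ce_representatives rep) :
  (* at all positive integers *)
  [/\ forall p q : nat, (0 < p)%N -> (0 < q)%N ->
        kappaZ eps p q
        = (\sum_(X in ce_classes G) #|X| * kappa_rho (rep X) p q)%N,
      forall p q : nat, (0 < p)%N -> (0 < q)%N ->
        kappabarZ G p q
        = (\sum_(X in ce_classes G) #|X| * kappabar_rho (rep X) p q)%N
    & forall c : nat, (forall rho : orientation G, #|ce_class rho| = c) ->
        (forall A B : finZmodType,
           kappaZ eps #|A| #|B| = (c * kappa eps A B)%N) /\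
        (forall p q : nat, (0 < p)%N -> (0 < q)%N ->
           kappabarZ G p q = (c * kappabar rep p q)%N)]
  /\
  (* as polynomials in x and y *)
  (forall (KZ KbarZ K Kbar : {poly {poly rat}})
      (Krho Kbarrho : orientation G -> {poly {poly rat}}),
      agrees KZ (kappaZ eps) ->
      agrees KbarZ (@kappabarZ G) ->
      agrees_mod K (kappa eps) ->
      agrees Kbar (kappabar rep) ->
      (forall rho, agrees (Krho rho) (kappa_rho rho)) ->
      (forall rho, agrees (Kbarrho rho) (kappabar_rho rho)) ->
    [/\ KZ = \sum_(X in ce_classes G) Krho (rep X) *+ #|X|,
        KbarZ = \sum_(X in ce_classes G) Kbarrho (rep X) *+ #|X|
      & forall c : nat, (forall rho : orientation G, #|ce_class rho| = c) ->
          KZ = K *+ c /\ KbarZ = Kbar *+ c]).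
Proof.
have kZ p q : (0 < p)%N -> (0 < q)%N -> kappaZ eps p q
    = (\sum_(X in ce_classes G) #|X| * kappa_rho (rep X) p q)%N.
  move=> _ _; rewrite kappaZ_sum.
  by apply: sum_ce_classes => // rho sigma /kappa_rho_ce.
have kbarZ p q : (0 < p)%N -> (0 < q)%N -> kappabarZ G p q
    = (\sum_(X in ce_classes G) #|X| * kappabar_rho (rep X) p q)%N.
  by move=> _ _; apply: sum_ce_classes => // rho sigma /kappabar_rho_ce.
have kbarc c : (forall rho : orientation G, #|ce_class rho| = c) ->
    forall p q : nat, (0 < p)%N -> (0 < q)%N ->
    kappabarZ G p q = (c * kappabar rep p q)%N.
  move=> cE p q p0 q0; rewrite kbarZ // big_distrr; apply: eq_bigr => X.
  by case/imsetP => rho _ ->; rewrite cE.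
split; first by split=> // c cE; split; [move=> A B; exact: kappaZ_modular|exact: kbarc].
move=> KZ KbarZ K Kbar Krho Kbarrho KZE KbarZE KE KbarE KrhoE KbarrhoE.
have agrees_sum (L : orientation G -> {poly {poly rat}}) F :
    (forall rho, agrees (L rho) (F rho)) ->
    agrees (\sum_(X in ce_classes G) L (rep X) *+ #|X|)
           (fun p q => \sum_(X in ce_classes G) #|X| * F (rep X) p q)%N.
  move=> LF p q p0 q0; rewrite !horner_sum natr_sum; apply: eq_bigr => X _.
  by rewrite !hornerMn LF // natrM mulr_natl.
split.
- apply: agrees_unique KZE _ => p q p0 q0; rewrite kZ //.
  exact: agrees_sum.
- apply: agrees_unique KbarZE _ => p q p0 q0; rewrite kbarZ //.
  exact: agrees_sum.
- move=> c cE; split.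
    (* The modular polynomial is evaluated through cyclic groups, which realise every pair of
       positive orders. *)
    apply: agrees_unique KZE _ => -[|p] [|q] // _ _.
    rewrite (kappaZ_cyclic eps p q cE) natrM !hornerMn mulr_natl -KE.
    by rewrite !card_ord.
  apply: agrees_unique KbarZE _ => p q p0 q0.
  by rewrite (kbarc c) // !hornerMn KbarE // natrM mulr_natl.
Qed.
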